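(* Let $\mu=l_2$ be a symmetric graded Lie algebra structure on a graded vector space $E=\oplus_{i\in\mathbb Z}E_i$ and let $\pi\in E_0$. Let $S$ be the Euler map of $E$. Then: (1) $\pi+S$ is a Nijenhuis vector valued form (with curvature $\pi$) with respect to $\mu$ and with square $2\pi+S$ if, and only if, $\pi$ is a Poisson element, i.e. $l_2(\pi,\pi)=0$. (2) Assuming (1) is satisfied, the deformed structure $[\pi+S,l_2]_{_{RN}}$ is a symmetric DGLA structure on $E$, with the same binary bracket $l_2$ and with differential $l_1=l_2(\pi,\cdot)$.
   Context: Let $E=\oplus_{i\in\mathbb Z}E_i$ be a graded vector space over $\mathbb R$ or $\mathbb C$; $|X|$ is the degree of homogeneous $X$. A symmetric vector valued $k$-form ($k\ge0$) is a graded symmetric $k$-linear map $K:E^{k}\to E$ (exchanging adjacent arguments $X,Y$ gives the sign $(-1)^{|X||Y|}$); a $0$-form is an element of $E$. It has degree $\bar K$ if $|K(X_1,\dots,X_k)|=|X_1|+\dots+|X_k|+\bar K$. A symmetric vector valued form is a formal sum of $k$-forms, $k\ge0$. For a $k$-form $K$ and $l$-form $L$, $$\iota_KL(X_1,\dots,X_{k+l-1})=\sum_{\sigma\in Sh(k,l-1)}\epsilon(\sigma)L(K(X_{\sigma(1)},\dots,X_{\sigma(k)}),X_{\sigma(k+1)},\dots,X_{\sigma(k+l-1)}),$$ with $Sh(k,l-1)$ the $(k,l-1)$-unshuffles and $\epsilon(\sigma)$ the Koszul sign; $\iota_KL=0$ if $l=0$, and $\iota_KL=L(K,\dots)$ if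 $k=0$. The Richardson–Nijenhuis bracket is $[K,L]_{_{RN}}=\iota_KL-(-1)^{\bar K\bar L}\iota_LK$, extended bilinearly. For $\mu$ of degree $1$, a symmetric vector valued form $\mathcal N$ of degree $0$ is Nijenhuis with respect to $\mu$ with square $\mathcal K$ if $\mathcal K$ has degree $0$, $[\mathcal N,[\mathcal N,\mu]_{_{RN}}]_{_{RN}}=[\mathcal K,\mu]_{_{RN}}$ and $[\mathcal N,\mathcal K]_{_{RN}}=0$; ''with curvature'' means that $\mathcal N$ has a $0$-form component. Euler map: $S(X)=-|X|X$ for homogeneous $X$. Symmetric graded Lie algebra structure: a graded symmetric bilinear map $l_2$ of degree $1$ with $l_2(l_2(X,Y),Z)+(-1)^{|Y||Z|}l_2(l_2(X,Z),Y)+(-1)^{|X|(|Y|+|Z|)}l_2(l_2(Y,Z),X)=0$. Symmetric DGLA structure $l_1+l_2$: such an $l_2$ together with a linear map $l_1$ of degree $1$, $l_1^2=0$, and $l_1(l_2(X,Y))+l_2(l_1X,Y)+(-1)^{|X|}l_2(X,l_1Y)=0$. *)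

(* Defs.v *)
From HB Require Import structures.
From mathcomp Require Import all_boot all_order all_algebra all_fingroup.
From mathcomp Require Import finmap.

Set Implicit Arguments.
Unset Strict Implicit.
Unset Printing Implicit Defensive.

Import GRing.Theory Num.Theory.
Local Open Scope ring_scope.

(* A Z-graded vector space, as an internal direct sum: [decomp x] is the
   finitely supported family of homogeneous components of [x]; it is the only
   such family with sum [x], by [piece_indep]. Any [numFieldType] is
   allowed as the field of scalars, in particular R and C. *)
Record gradedSpace (K : numFieldType) := GradedSpace {
  carrier :> lmodType K;
  piece : int -> {pred carrier};
  decomp : carrier -> {fsfun int -> carrier with 0};
  piece_submod : forall i, submod_closed (piece i);
  decomp_piece : forall x i, decomp x i \in piece i;
  decomp_sum : forall x, x = \sum_(i <- finsupp (decomp x)) decomp x i;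
  piece_indep : forall c : {fsfun int -> carrier with 0},
    (forall i, c i \in piece i) ->
    \sum_(i <- finsupp c) c i = 0 -> forall i, c i = 0
}.

Arguments piece {K} g i.

Section Forms.
Context (K : numFieldType) (E : gradedSpace K).

Definition gsign (i j : int) : K := (-1) ^ (i * j).

(* A formal sum of k-ary maps E^k -> E, k >= 0: the k-ary component is the
   restriction to the sequences of size k. *)
Definition vform := seq E -> E.

Definition multilinear (F : vform) := forall (s1 s2 : seq E) (a : K) (x y : E),
  F (s1 ++ (a *: x + y) :: s2) = a *: F (s1 ++ x :: s2) + F (s1 ++ y :: s2).

Definition graded_sym (F : vform) :=
  forall (s1 s2 : seq E) (i j : int) (x y : E),
    x \in piece E i -> y \in piece E j ->
    F (s1 ++ x :: y :: s2) = gsign i j *: F (s1 ++ y :: x :: s2).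

(* A sequence of vectors tagged with degrees. *)
Definition homogeneous (t : seq (int * E)) :=
  all (fun p => p.2 \in piece E p.1) t.

Definition has_degree (d : int) (F : vform) := forall t : seq (int * E),
  homogeneous t -> F [seq p.2 | p <- t] \in piece E (\sum_(p <- t) p.1 + d).

Definition sym_form (d : int) (F : vform) :=
  [/\ multilinear F, graded_sym F & has_degree d F].

Definition form0 (x : E) : vform := fun s => if s is [::] then x else 0.
Definition form1 (f : E -> E) : vform := fun s => if s is [:: x] then f x else 0.
Definition form2 (f : E -> E -> E) : vform :=
  fun s => if s is [:: x; y] then f x y else 0.

Definition curvature (F : vform) : E := F [::].

(* (k, n - k)-unshuffles: increasing on the first k and on the last n - k
   indices. *)
Definition unshuffle n (k : nat) (sigma : 'S_n) :=
  [forall i : 'I_n, forall j : 'I_n,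
    (i < j)%N && ((j < k)%N || (k <= i)%N) ==> (sigma i < sigma j)%N].

(* X_1 ... X_n = koszul sigma d X_(sigma 1) ... X_(sigma n) in the graded
   symmetric algebra, when X_i has degree d i. *)
Definition koszul n (sigma : 'S_n) (d : 'I_n -> int) : K :=
  \prod_(p : 'I_n * 'I_n | (p.1 < p.2)%N && (sigma p.2 < sigma p.1)%N)
     gsign (d (sigma p.1)) (d (sigma p.2)).

(* iota_F G on homogeneous arguments X_1, ..., X_n. The k-ary component of F
   meets the (n - k + 1)-ary one of G, so that a 0-ary component of G never
   contributes. *)
Definition iota_hom (F G : vform) (t : seq (int * E)) : E :=
  \sum_(k < (size t).+1) \sum_(sigma : 'S_(size t) | unshuffle k sigma)
    let s := [seq (nth (0, 0) t (sigma i)).2 | i <- enum 'I_(size t)] in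
    koszul sigma (fun i => (nth (0, 0) t i).1)
      *: G (F (take k s) :: drop k s).

Definition components (x : E) : seq (int * E) :=
  [seq (i, decomp x i) | i <- finsupp (decomp x)].

(* All the ways of choosing one homogeneous component in each entry. *)
Definition expansions (s : seq E) : seq (seq (int * E)) :=
  foldr (fun x ts => [seq p :: t | p <- components x, t <- ts]) [:: [::]] s.

(* The multilinear extension of [iota_hom] to arbitrary arguments. *)
Definition iota (F G : vform) : vform :=
  fun s => \sum_(t <- expansions s) iota_hom F G t.

(* Richardson-Nijenhuis bracket of F of degree a and G of degree b; the degrees
   are explicit because the zero form has every degree. *)
Definition rn_bracket (a b : int) (F G : vform) : vform :=
  fun s => iota F G s - gsign a b *: iota G F s.

(* The form N, of degree 0, is Nijenhuis with respect to mu, of degree 1, with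
   square Q. *)
Definition nijenhuis (mu N Q : vform) :=
  [/\ sym_form 1 mu, sym_form 0 N, sym_form 0 Q,
      rn_bracket 0 1 N (rn_bracket 0 1 N mu) =1 rn_bracket 0 1 Q mu
    & rn_bracket 0 0 N Q =1 (fun=> 0)].

(* The linear map equal to multiplication by - i on the piece of degree i. *)
Definition euler (x : E) : E :=
  - \sum_(i <- finsupp (decomp x)) i%:~R *: decomp x i.

Definition sym_GLA (l2 : E -> E -> E) :=
  sym_form 1 (form2 l2) /\
  forall (i j k : int) (x y z : E),
    x \in piece E i -> y \in piece E j -> z \in piece E k ->
    l2 (l2 x y) z + gsign j k *: l2 (l2 x z) y
      + gsign i (j + k) *: l2 (l2 y z) x = 0.

Definition sym_DGLA (l1 : E -> E) (l2 : E -> E -> E) :=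
  [/\ sym_GLA l2, sym_form 1 (form1 l1), (forall x, l1 (l1 x) = 0)
    & forall (i : int) (x y : E), x \in piece E i ->
        l1 (l2 x y) + l2 (l1 x) y + (-1) ^ i *: l2 x (l1 y) = 0].

End Forms.

(* Main.v *)
Require Import Defs.
From mathcomp Require Import all_boot all_order all_algebra all_fingroup.
From mathcomp Require Import finmap.
From HB Require Import structures.
Local Open Scope ring_scope.

Import GRing.Theory Num.Theory.

(** Everything follows from one formula: for p of degree 0, S the Euler map and
    F a symmetric form of degree d,
      [p + S, F] = F(p, -) + d F   (rn_bracket_euler).
    The constant p contributes F(p, -), because F inserted into a 0-form gives
    nothing. The Euler map counts degrees: on homogeneous X_1, ..., X_n, the sum
    over (1, n-1)-unshuffles applies S to each X_i in turn, and graded symmetry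
    moves X_i back to its place at the cost of exactly the Koszul sign, so that
    iota_S F = - (|X_1| + ... + |X_n|) F; on the other side S multiplies the
    value of F by - (|X_1| + ... + |X_n| + d), and the difference is d F.

    For mu = l2 this gives [p + S, mu] = mu(p, -) + mu, again symmetric of
    degree 1, hence
      [p + S, [p + S, mu]] = mu(p, p, -) + 2 mu(p, -) + mu
                           = mu(p, p, -) + [2p + S, mu],
    and mu(p, p, -) is the 0-form l2(p, p). Moreover [p + S, 2p + S] is
    (2p + S)(p, -), which is the constant S(p) = 0. So the Nijenhuis condition
    says exactly that l2(p, p) = 0.

    The deformed bracket l2(p, -) + l2 was just computed. By the Jacobi identity
    l2(p, -) is a derivation of l2 up to sign (jacobi_leibniz), and its value on
    the bracket of p with x gives 2 l2(p, l2(p, x)) = - l2(l2(p, p), x) = 0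
    (poisson_square). *)

(** * Homogeneous components *)

HB.instance Definition _ (K : numFieldType) (E : gradedSpace K) (i : int) :=
  GRing.isSubmodClosed.Build K E (piece E i) (@piece_submod K E i).

Section Components.
Context (K : numFieldType) (E : gradedSpace K).

Lemma big_finsupp_widen {T : choiceType} {V : zmodType} {W : nmodType}
    (c : {fsfun T -> V with 0}) (r : seq T) (F : T -> V -> W) :
  uniq r -> {subset finsupp c <= r} -> (forall i, F i 0 = 0) ->
  \sum_(i <- finsupp c) F i (c i) = \sum_(i <- r) F i (c i).
Proof.
move=> r_uniq sub_r F0.
rewrite [RHS](bigID (mem (finsupp c))) /= [X in _ + X]big1 ?addr0; last first.
  by move=> i ci; rewrite fsfun_dflt.
rewrite -[RHS]big_filter; apply/perm_big/uniq_perm.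
- exact: fset_uniq.
- exact: filter_uniq.
- move=> i; rewrite mem_filter /=.
  by case: (boolP (i \in finsupp c)) => [/sub_r ->|].
Qed.

(** The support of a decomposition varies with the vector; uniqueness against a
    family over an arbitrary list r lets the decompositions of several vectors
    be compared over one common list. *)
Lemma decomp_unique (r : seq int) (f : int -> E) (x : E) (i : int) :
  uniq r -> (forall j, f j \in piece E j) -> x = \sum_(j <- r) f j ->
  decomp x i = if i \in r then f i else 0.
Proof.
move=> r_uniq f_piece x_sum.
pose g j := if j \in r then f j else 0.
have g_piece j : g j \in piece E j.
  by rewrite /g; case: ifP => // _; exact: rpred0.
pose s := undup (r ++ finsupp (decomp x)).
pose c : {fsfun int -> E with 0} :=
  [fsfun j in [fset j in s]%fset => g j - decomp x j].
have cE j : c j = g j - decomp x j.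
  rewrite fsfunE inE /= mem_undup mem_cat /g.
  case: (j \in r) => //=; case: ifPn => // /fsfun_dflt ->.
  by rewrite subr0.
suff: c i = 0 by rewrite cE => /eqP; rewrite subr_eq0 => /eqP.
apply: piece_indep => [j|]; first by rewrite cE rpredB // decomp_piece.
rewrite (@big_finsupp_widen _ _ _ c s (fun _ v => v)) ?undup_uniq //;
  last first.
  move=> j; rewrite mem_finsupp cE mem_undup mem_cat; apply: contraNT.
  rewrite negb_or => /andP[jr /fsfun_dflt ->].
  by rewrite /g (negbTE jr) subrr.
rewrite (eq_bigr _ (fun j _ => cE j)) sumrB.
rewrite -(@big_finsupp_widen _ _ _ (decomp x) s (fun _ v => v)) ?undup_uniq //;
  last by move=> j jx; rewrite mem_undup mem_cat jx orbT.
rewrite -decomp_sum; apply/eqP; rewrite subr_eq0; apply/eqP.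
rewrite [RHS]x_sum /g -big_mkcond -big_filter; apply/perm_big/uniq_perm => //.
  by rewrite filter_uniq ?undup_uniq.
by move=> j; rewrite mem_filter mem_undup mem_cat; case: (j \in r).
Qed.

Lemma decomp_linear (a : K) (x y : E) (i : int) :
  decomp (a *: x + y) i = a *: decomp x i + decomp y i.
Proof.
pose r := undup (finsupp (decomp x) ++ finsupp (decomp y)).
rewrite (@decomp_unique r (fun j => a *: decomp x j + decomp y j)).
- case: ifPn => //; rewrite mem_undup mem_cat negb_or => /andP[ix iy].
  by rewrite !fsfun_dflt // scaler0 addr0.
- exact: undup_uniq.
- by move=> j; rewrite rpredD ?rpredZ ?decomp_piece.
rewrite big_split -scaler_sumr /=.
rewrite -!(@big_finsupp_widen _ _ _ (decomp _) r (fun _ v => v)) ?undup_uniq //.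
- by rewrite -!decomp_sum.
- by move=> j jy; rewrite mem_undup mem_cat jy orbT.
- by move=> j jx; rewrite mem_undup mem_cat jx.
Qed.

Lemma euler_linear (a : K) (x y : E) :
  euler (a *: x + y) = a *: euler x + euler y.
Proof.
pose r := undup (finsupp (decomp x) ++ finsupp (decomp y)
                 ++ finsupp (decomp (a *: x + y))).
have euler_r (z : E) : {subset finsupp (decomp z) <= r} ->
    euler z = - \sum_(i <- r) i%:~R *: decomp z i.
  move=> sub_r; congr (- _).
  apply: (@big_finsupp_widen _ _ _ (decomp z) r (fun i v => i%:~R *: v)) => //.
    exact: undup_uniq.
  by move=> i; rewrite scaler0.
rewrite !euler_r; try by move=> i iz; rewrite mem_undup !mem_cat iz ?orbT.
rewrite scalerN -opprD scaler_sumr -big_split /=; congr (- _).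
apply: eq_bigr => i _.
by rewrite decomp_linear scalerDr !scalerA mulrC.
Qed.

Lemma eulerE (i : int) (x : E) : x \in piece E i -> euler x = - (i%:~R *: x).
Proof.
move=> xi.
have decompE j : decomp x j = if j == i then x else 0.
  rewrite (@decomp_unique [:: i] (fun j => if j == i then x else 0)) //.
  - by rewrite inE; case: (j == i).
  - by move=> k; case: eqP => [->|_] //; exact: rpred0.
  - by rewrite big_seq1 eqxx.
congr (- _).
rewrite (@big_finsupp_widen _ _ _ (decomp x) [:: i] (fun i v => i%:~R *: v)) //.
- by rewrite big_seq1 decompE eqxx.
- move=> j; rewrite mem_finsupp decompE inE.
  by case: (j == i); rewrite // eqxx.
- by move=> j; rewrite scaler0.
Qed.

Lemma piece_decomp_ind (P : E -> Prop) :
  P 0 -> (forall x y, P x -> P y -> P (x + y)) ->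
  (forall i x, x \in piece E i -> P x) -> forall x, P x.
Proof.
move=> P0 PD Pp x; rewrite (decomp_sum x).
by apply: big_ind => // i _; apply: (Pp i); exact: decomp_piece.
Qed.

(** * Symmetric forms *)

Implicit Types (F G : vform E) (t : seq (int * E)).

Lemma multilinear0 F s1 s2 : multilinear F -> F (s1 ++ 0 :: s2) = 0.
Proof.
by move=> /(_ s1 s2 (-1) 0 0); rewrite scaler0 addr0 scaleN1r addNr.
Qed.

Lemma multilinearD F s1 s2 x y : multilinear F ->
  F (s1 ++ (x + y) :: s2) = F (s1 ++ x :: s2) + F (s1 ++ y :: s2).
Proof. by move=> /(_ s1 s2 1 x y); rewrite !scale1r. Qed.

Lemma multilinearZ F s1 s2 a x : multilinear F ->
  F (s1 ++ a *: x :: s2) = a *: F (s1 ++ x :: s2).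
Proof. by move=> F_lin; rewrite -[a *: x]addr0 F_lin multilinear0 // addr0. Qed.

Lemma eq_sym_form d F G : F =1 G -> sym_form d F -> sym_form d G.
Proof.
move=> FG [F_lin F_sym F_deg]; split.
- by move=> s1 s2 a x y; rewrite -!FG.
- by move=> s1 s2 i j x y xi yj; rewrite -!FG; exact: F_sym.
- by move=> t /F_deg; rewrite FG.
Qed.

Lemma sym_formD d F G : sym_form d F -> sym_form d G -> sym_form d (F \+ G).
Proof.
move=> [F_lin F_sym F_deg] [G_lin G_sym G_deg]; split.
- by move=> s1 s2 a x y /=; rewrite F_lin G_lin scalerDr addrACA.
- by move=> s1 s2 i j x y xi yj /=; rewrite scalerDr (F_sym _ _ i j) //
    (G_sym _ _ i j).
- by move=> t t_hom /=; rewrite rpredD ?F_deg ?G_deg.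
Qed.

Lemma sym_form_contract d F p : p \in piece E 0 -> sym_form d F ->
  sym_form d (fun s => F (p :: s)).
Proof.
move=> p0 [F_lin F_sym F_deg]; split.
- by move=> s1 s2 a x y; exact: (F_lin (p :: s1)).
- by move=> s1 s2 i j x y; exact: (F_sym (p :: s1)).
- move=> t t_hom; have := F_deg ((0, p) :: t).
  by rewrite /= p0 big_cons add0r; exact.
Qed.

Lemma sym_form0 p : p \in piece E 0 -> sym_form 0 (form0 p).
Proof.
move=> p0; split.
- by move=> [|u s1] s2 a x y /=; rewrite scaler0 addr0.
- by move=> [|u s1] s2 i j x y xi yj /=; rewrite scaler0.
- case=> [|u t] _ /=; last exact: rpred0.
  by rewrite big_nil addr0.
Qed.

Lemma sym_form1 d (f : E -> E) :
  (forall (a : K) x y, f (a *: x + y) = a *: f x + f y) ->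
  (forall i x, x \in piece E i -> f x \in piece E (i + d)) ->
  sym_form d (form1 f).
Proof.
move=> f_lin f_deg; split.
- case=> [|u [|v s1]] [|w s2] a x y //=; by rewrite ?scaler0 ?addr0 ?f_lin.
- by case=> [|u [|v s1]] s2 i j x y _ _ //=; rewrite scaler0.
- case=> [|[i x] [|q t]] //= t_hom; try exact: rpred0.
  by rewrite big_seq1; apply: f_deg; case/andP: t_hom.
Qed.

Lemma sym_form_euler : sym_form 0 (form1 (@euler K E)).
Proof.
apply: sym_form1 => [|i x xi]; first exact: euler_linear.
by rewrite (eulerE _ _ xi) addr0 rpredN rpredZ.
Qed.

(** * Reduction to homogeneous arguments *)

Lemma homogeneous_expansions (s : seq E) t :
  t \in expansions s -> homogeneous t.
Proof.
elim: s t => [|x s IH] t /=; first by rewrite inE => /eqP ->.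
move=> /allpairsP[[p u] /= [p_x u_s ->]] /=; rewrite IH // andbT.
by case/mapP: p_x => i _ -> /=; exact: decomp_piece.
Qed.

(** The prefix s1 both carries the induction and allows a constant to be
    inserted in front of the expanded arguments. *)
Lemma multilinear_expansions F s1 s : multilinear F ->
  F (s1 ++ s) = \sum_(t <- expansions s) F (s1 ++ [seq q.2 | q <- t]).
Proof.
move=> F_lin; elim: s s1 => [|x s IH] s1 /=; first by rewrite big_seq1.
rewrite big_allpairs_dep big_map {1}(decomp_sum x).
rewrite (big_morph (fun y => F (s1 ++ y :: s)) (id1 := 0) (op1 := +%R));
  [|by move=> y z; exact: multilinearD|exact: multilinear0].
apply: eq_bigr => i _.
rewrite -cat_rcons IH; apply: eq_bigr => t _.
by rewrite cat_rcons.
Qed.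

(** * Koszul signs *)

Lemma gsign0l (j : int) : gsign K 0 j = 1.
Proof. by rewrite /gsign mul0r expr0z. Qed.

Lemma gsign0r (j : int) : gsign K j 0 = 1.
Proof. by rewrite /gsign mulr0 expr0z. Qed.

Lemma gsignDr (i j k : int) : gsign K i (j + k) = gsign K i j * gsign K i k.
Proof. by rewrite /gsign mulrDr expfzDr // oppr_eq0 oner_eq0. Qed.

Lemma gsignC (i j : int) : gsign K i j = gsign K j i.
Proof. by rewrite /gsign mulrC. Qed.

Lemma gsign_sqr (i j : int) : gsign K i j * gsign K i j = 1.
Proof.
rewrite /gsign.
have [->|->] : (-1 : K) ^ (i * j) = 1 \/ (-1 : K) ^ (i * j) = -1.
- case: (i * j) => n; last rewrite NegzE -invr_expz.
    by rewrite -exprnP -signr_odd; case: odd; [right|left].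
  by rewrite -exprnP -signr_odd; case: odd; [right|left];
    rewrite /= ?invrN1 ?invr1.
- by rewrite mulr1.
- by rewrite mulrNN mulr1.
Qed.

(** The sign is written with the total degree of the arguments jumped over, the
    form in which koszul_lift_perm produces it. *)
Lemma graded_sym_front F t1 t2 (i : int) (x : E) :
  graded_sym F -> homogeneous t1 -> x \in piece E i ->
  gsign K i (\sum_(q <- t1) q.1)
    *: F (x :: [seq q.2 | q <- t1] ++ [seq q.2 | q <- t2])
  = F ([seq q.2 | q <- t1] ++ x :: [seq q.2 | q <- t2]).
Proof.
move=> F_sym; elim/last_ind: t1 t2 => [|t1 q IH] t2 t_hom xi.
  by rewrite big_nil gsign0r scale1r.
move: t_hom; rewrite /homogeneous all_rcons => /andP[q_hom t_hom].
rewrite -cats1 big_cat big_seq1 gsignDr map_cat -!catA /=.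
rewrite (F_sym _ _ q.1 i) // (gsignC q.1) -(IH (q :: t2)) //= scalerA.
by rewrite mulrC.
Qed.

(** * Unshuffles *)

Lemma increasing_perm n (sigma : 'S_n) :
  (forall i j : 'I_n, (i < j)%N -> (sigma i < sigma j)%N) -> sigma = 1%g.
Proof.
move=> incr.
have ge_id (i : 'I_n) : (i <= sigma i)%N.
  case: i => m; elim: m => // m IH lt_m.
  exact: leq_ltn_trans (IH (ltnW lt_m)) (incr (Ordinal (ltnW lt_m)) _ _).
have le_id m : forall i : 'I_n, (n - i <= m)%N -> (sigma i <= i)%N.
  elim: m => [|m IH] i; first by rewrite leqn0 subn_eq0 leqNgt ltn_ord.
  move=> le_i; have [lt_i|] := ltnP i.+1 n; last first.
    by move=> ?; rewrite -ltnS; apply: leq_trans (ltn_ord _) _.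
  rewrite -ltnS; apply: (leq_trans (incr i (Ordinal lt_i) (ltnSn i))).
  apply: (IH (Ordinal lt_i)) => /=.
  by rewrite -ltnS; apply: leq_trans le_i; rewrite ltn_sub2l.
apply/permP => i; rewrite perm1; apply/val_inj/eqP => /=.
by rewrite eqn_leq ge_id (le_id (n - i)%N).
Qed.

Lemma unshuffle_all n (k : nat) (sigma : 'S_n) :
  (k == 0%N) || (n <= k)%N -> unshuffle k sigma = (sigma == 1%g).
Proof.
move=> k_triv; apply/forallP/eqP => [sigma_incr|-> i]; last first.
  by apply/forallP => j; rewrite !perm1; apply/implyP; case/andP.
apply: increasing_perm => i j ij.
move/forallP/(_ j)/implyP: (sigma_incr i); apply; rewrite ij /=.
case/orP: k_triv => [/eqP ->|nk]; first by rewrite orbT.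
by rewrite (leq_trans (ltn_ord j) nk).
Qed.

Lemma koszul1 n (d : 'I_n -> int) : koszul K 1 d = 1.
Proof.
rewrite /koszul big_pred0 // => q; rewrite !perm1.
by case: ltngtP; rewrite ?andbF.
Qed.

Lemma map_nth_ord {T S : Type} (x0 : T) (f : T -> S) (t : seq T) :
  [seq f (nth x0 t (val i)) | i <- enum 'I_(size t)] = map f t.
Proof.
rewrite (map_comp (fun i => f (nth x0 t i)) val) val_enum_ord.
by rewrite (map_comp f (nth x0 t)) map_nth_iota0 // take_size.
Qed.

Lemma lift_mono n (h : 'I_n) (i j : 'I_n.-1) :
  (lift h i < lift h j)%N = (i < j)%N.
Proof. by rewrite /= !ltnNge leq_bump2. Qed.

(** A (1, n)-unshuffle is determined by the index that it brings to the front,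
    so that sums over these unshuffles are sums over an index. *)
Lemma unshuffle1 n (sigma : 'S_n.+1) :
  unshuffle 1 sigma = (lift_perm ord0 (sigma ord0) 1 == sigma)%g.
Proof.
set L := lift_perm _ _ _; apply/forallP/eqP => [sigma_incr|<- i].
  (* sigma and L agree at 0 and are both increasing on the other indices, so
     sigma * L^-1 is increasing. *)
  suff : (sigma * L^-1 = 1)%g by move/eqP; rewrite -eq_mulgV1 => /eqP.
  have fix0 : (sigma * L^-1)%g ord0 = ord0.
    by apply: (@perm_inj _ L); rewrite permM permKV lift_perm_id.
  apply: increasing_perm => i j.
  case: (unliftP ord0 j) => [j'|] -> //; case: (unliftP ord0 i) => [i'|] -> ij.
    have lifts k : exists k', sigma (lift ord0 k) = lift (sigma ord0) k'
                        /\ (sigma * L^-1)%g (lift ord0 k) = lift ord0 k'.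
      have [|k' def_k' _] := @unlift_some _ (sigma ord0) (sigma (lift ord0 k)).
        by rewrite (inj_eq perm_inj) neq_lift.
      exists k'; split=> //; apply: (@perm_inj _ L).
      by rewrite permM permKV def_k' lift_perm_lift perm1.
    have [i2 [si ->]] := lifts i'; have [j2 [sj ->]] := lifts j'.
    have /forallP/(_ (lift ord0 j')) := sigma_incr (lift ord0 i').
    by rewrite ij /= si sj lift_mono.
  rewrite fix0 lt0n; apply/eqP => tau0.
  have : (sigma * L^-1)%g (lift ord0 j') = ord0 by exact: val_inj.
  by rewrite -{2}fix0 => /perm_inj /eqP; rewrite eq_sym (negbTE (neq_lift _ _)).
apply/forallP => j; apply/implyP => /andP[ij].
case: (unliftP ord0 j) ij => [j'|] ->; case: (unliftP ord0 i) => [i'|] -> //.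
by rewrite !lift_perm_lift !perm1 !lift_mono.
Qed.

(** The inversions of the permutation that brings h to the front are the pairs
    formed by h and a smaller index. *)
Lemma koszul_lift_perm n (h : 'I_n.+1) (d : 'I_n.+1 -> int) :
  koszul K (lift_perm ord0 h 1) d
  = gsign K (d h) (\sum_(j : 'I_n.+1 | (j < h)%N) d j).
Proof.
set L := lift_perm _ _ _.
rewrite (big_morph (gsign K (d h)) (gsignDr _) (gsign0r _)).
rewrite /koszul -(pair_big_dep xpredT (fun a b : 'I_n.+1 =>
  (a < b)%N && (L b < L a)%N)
  (fun a b => gsign K (d (L a)) (d (L b)))) /=.
rewrite big_ord_recl [X in _ * X]big1 ?mulr1 => [|a _]; last first.
  apply: big_pred0 => b; case: (unliftP ord0 b) => [b'|] -> //.
  by rewrite !lift_perm_lift !perm1 !lift_mono; case: ltngtP.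
rewrite lift_perm_id [RHS](reindex_inj (@perm_inj _ L)) /=.
apply: eq_bigl => b; case: (unliftP ord0 b) => [b'|] -> //.
by rewrite lift_perm_id ltnn.
Qed.

Lemma map_nth_lift_perm {T S : Type} (x0 x : T) (f : T -> S) (t : seq T)
    (h : 'I_(size t).+1) :
  [seq f (nth x0 (x :: t) (val (lift_perm ord0 h 1%g i)))
     | i <- enum 'I_(size t).+1]
  = f (nth x0 (x :: t) h)
    :: [seq f y | y <- take h (x :: t) ++ drop h.+1 (x :: t)].
Proof.
rewrite enum_ordSl /= lift_perm_id; congr cons; rewrite -map_comp.
rewrite -(map_nth_ord x0).
have size_t' : size (take h (x :: t) ++ drop h.+1 (x :: t)) = size t.
  rewrite size_cat size_take size_drop /= ltn_ord.
  by rewrite subSS subnKC // -ltnS.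
rewrite size_t'; apply: eq_map => i /=.
rewrite lift_perm_lift perm1 /= nth_cat size_take /= ltn_ord.
rewrite /bump; case: (ltnP i h) => ih; first by rewrite add0n nth_take.
by rewrite nth_drop addSn subnKC.
Qed.

(** * Contraction with a constant and with the Euler map *)

(** The 0-ary part of the inserted form gives F(p, -). In its unary part the
    sign of each unshuffle is undone by graded symmetry (graded_sym_front), so
    each argument contributes minus its degree times the same value of F. *)
Lemma iota_hom_eulerl p F t :
  multilinear F -> graded_sym F -> homogeneous t ->
  iota_hom (form0 p \+ form1 (@euler K E)) F t =
  F (p :: [seq q.2 | q <- t]) - (\sum_(q <- t) q.1)%:~R *: F [seq q.2 | q <- t].
Proof.
move=> F_lin F_sym t_hom; rewrite /iota_hom big_ord_recl; congr (_ + _).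
  rewrite (big_pred1 1%g) => [|sigma]; last by rewrite unshuffle_all.
  rewrite koszul1 scale1r take0 drop0 /= addr0.
  under eq_map do rewrite perm1.
  by rewrite (map_nth_ord _ snd).
case: t t_hom => [|x t] t_hom; first by rewrite big_ord0 big_nil scale0r oppr0.
rewrite big_ord_recl [X in _ + X]big1 ?addr0 => [|k _]; last first.
  (* The inserted form has no component of arity at least 2. *)
  apply: big1 => sigma _ /=.
  set s := [seq _ | i <- _].
  have size_s : size s = (size t).+1 by rewrite size_map size_enum_ord.
  have : (1 < size (take k.+2 s))%N.
    by rewrite size_takel // size_s ltnS; exact: ltn_ord k.
  by case: (take _ s) => [|a [|b u]] //= _;
    rewrite addr0 (multilinear0 _ [::]) // scaler0.
rewrite (reindex_onto (fun h => lift_perm ord0 h 1%g)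
  (fun sigma : 'S_(size t).+1 => sigma ord0)) /=;
  last by move=> sigma; rewrite unshuffle1 => /eqP.
transitivity (\sum_(h < (size t).+1)
    - ((nth (0, 0) (x :: t) h).1%:~R *: F [seq q.2 | q <- x :: t])); last first.
  by rewrite sumrN -scaler_suml -(rmorph_sum (intmul 1)) (big_nth (0, 0))
    big_mkord.
apply: eq_big => [h|h _]; first by rewrite unshuffle1 lift_perm_id !eqxx.
rewrite koszul_lift_perm (map_nth_lift_perm _ _ snd) /= take0 drop0 add0r.
set y := nth _ _ _; set u := x :: t.
have def_u : u = take h u ++ y :: drop h.+1 u.
  by rewrite -drop_nth ?cat_take_drop.
have: homogeneous u by [].
rewrite {1}def_u /homogeneous all_cat => /andP[hom1 /= /andP[hom_y _]].
rewrite (eulerE _ _ hom_y) -scaleNr (multilinearZ _ [::]) //= scalerA mulrC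
  -scalerA scaleNr.
have front : gsign K y.1 (\sum_(q <- take h u) q.1)
    *: F (y.2 :: [seq q.2 | q <- take h u ++ drop h.+1 u])
    = F [seq q.2 | q <- u].
  by rewrite map_cat graded_sym_front // [in RHS]def_u map_cat.
rewrite -[in RHS]/[seq q.2 | q <- u] -front.
rewrite (big_nth (0, 0)) size_takel 1?ltnW ?(ltn_ord h) // big_mkord.
rewrite (big_ord_widen (size t).+1 (fun j => (nth (0, 0) (take h u) j).1)) //;
  last by rewrite (ltnW (ltn_ord h)).
by congr (- (_ *: (gsign _ _ _ *: _))); apply: eq_bigr => j jh;
  rewrite nth_take.
Qed.

(** The constant p has no slot to receive F, and the Euler map has a single one:
    only the trivial unshuffle, which feeds all the arguments to F, remains. *)
Lemma iota_hom_eulerr p F t d : has_degree d F -> homogeneous t ->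
  iota_hom F (form0 p \+ form1 (@euler K E)) t
  = - ((\sum_(q <- t) q.1 + d)%:~R *: F [seq q.2 | q <- t]).
Proof.
move=> F_deg t_hom; rewrite /iota_hom big_ord_recr big1 /= => [|k _];
  last first.
  apply: big1 => sigma _ /=; case def_s: (drop k _) => [|a s];
    last by rewrite addr0 scaler0.
  move/(congr1 size)/eqP: def_s; rewrite size_drop size_map size_enum_ord.
  by rewrite subn_eq0 leqNgt ltn_ord.
rewrite add0r (big_pred1 1%g) => [|sigma];
  last by rewrite unshuffle_all ?leqnn ?orbT.
rewrite koszul1 scale1r.
under eq_map do rewrite perm1.
rewrite (map_nth_ord _ snd) take_oversize ?drop_oversize ?size_map //= add0r.
by apply: eulerE; exact: F_deg.
Qed.

(** The degrees of the arguments cancel between the two contractions, which is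
    why the result is again given by one formula on all arguments, homogeneous
    or not. *)
Lemma rn_bracket_euler p F d : p \in piece E 0 -> sym_form d F ->
  rn_bracket 0 d (form0 p \+ form1 (@euler K E)) F
  =1 (fun s => F (p :: s) + d%:~R *: F s).
Proof.
move=> p0 [F_lin F_sym F_deg] s.
rewrite /rn_bracket gsign0l scale1r /iota -sumrB.
rewrite (multilinear_expansions _ [:: p] s F_lin).
rewrite (multilinear_expansions _ [::] s F_lin).
rewrite scaler_sumr -big_split /= big_seq [RHS]big_seq.
apply: eq_bigr => t /homogeneous_expansions t_hom.
rewrite iota_hom_eulerl // (iota_hom_eulerr _ _ _ d) // opprK -addrA;
  congr (_ + _).
by rewrite rmorphD scalerDl addKr.
Qed.

(** * Poisson elements *)

(** This is the Jacobi identity at (p, x, y), with p and x brought to the front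
    by graded symmetry; as p has degree 0, only the sign of x remains. *)
Lemma jacobi_leibniz (l2 : E -> E -> E) p : sym_GLA l2 -> p \in piece E 0 ->
  forall (i : int) x y, x \in piece E i ->
  l2 p (l2 x y) + l2 (l2 p x) y + (-1) ^ i *: l2 x (l2 p y) = 0.
Proof.
move=> [[l2_lin l2_sym l2_deg] jacobi] p0 i x y xi.
have l2D u v w : l2 u (v + w) = l2 u v + l2 u w.
  by exact: (multilinearD _ [:: u] [::] v w l2_lin).
have l20 u : l2 u 0 = 0 by exact: (multilinear0 _ [:: u] [::] l2_lin).
have l2_piece j k u v :
    u \in piece E j -> v \in piece E k -> l2 u v \in piece E (j + k + 1).
  move=> uj vk; have := l2_deg [:: (j, u); (k, v)].
  by rewrite /= uj vk !big_cons big_nil addr0; exact.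
elim/piece_decomp_ind: y => [|y z IHy IHz|j y yj].
- by rewrite !l20 scaler0 !addr0.
- by rewrite !l2D scalerDr (addrACA (l2 p _)) [LHS]addrACA IHy IHz addr0.
have := jacobi _ _ _ _ _ _ p0 xi yj.
have /= -> := l2_sym [::] [::] _ _ _ _ (l2_piece _ _ _ _ p0 yj) xi.
have /= -> := l2_sym [::] [::] _ _ _ _ (l2_piece _ _ _ _ xi yj) p0.
rewrite gsign0l gsign0r !scale1r add0r scalerA (gsignC _ i) gsignDr mulrA
  gsign_sqr mul1r.
by rewrite /gsign mulr1 addrC addrA.
Qed.

(** The derivation l2(p, -), applied to the bracket of p with x, gives
    2 l2(p, l2(p, x)) = - l2(l2(p, p), x). *)
Lemma poisson_square (l2 : E -> E -> E) p : sym_GLA l2 -> p \in piece E 0 ->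
  l2 p p = 0 -> forall x, l2 p (l2 p x) = 0.
Proof.
move=> l2_GLA p0 p_poisson x.
have := jacobi_leibniz _ _ l2_GLA p0 _ _ x p0.
case: l2_GLA => [[l2_lin _ _] _].
have /= -> : form2 l2 [:: l2 p p; x] = 0.
  by rewrite p_poisson; exact: (multilinear0 _ [::] [:: x] l2_lin).
rewrite addr0 expr0z scale1r -mulr2n -scaler_nat => /eqP.
by rewrite scaler_eq0 pnatr_eq0 => /eqP.
Qed.

Lemma sym_form_poisson (l2 : E -> E -> E) p : sym_form 1 (form2 l2) ->
  p \in piece E 0 -> sym_form 1 (form1 (l2 p)).
Proof.
move=> [l2_lin _ l2_deg] p0; apply: sym_form1 => [a x y|i x xi].
  exact: (l2_lin [:: p] [::]).
have := l2_deg [:: (0, p); (i, x)].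
by rewrite /= p0 xi !big_cons big_nil add0r addr0; exact.
Qed.

End Components.

Arguments eulerE {K E i x}.
Arguments multilinearZ {K E F s1 s2 a x}.
Arguments eq_sym_form {K E d F G}.
Arguments rn_bracket_euler {K E p F d}.

Theorem corollary2p4p8 (K : numFieldType) (E : gradedSpace K)
    (l2 : E -> E -> E) (p : E) :
  sym_GLA l2 -> p \in piece E 0 ->
  let N := form0 p \+ form1 (@euler K E) in
  let Q := form0 (2 *: p) \+ form1 (@euler K E) in
  ((nijenhuis (form2 l2) N Q /\ curvature N = p) <-> l2 p p = 0) /\
  (nijenhuis (form2 l2) N Q ->
     rn_bracket 0 1 N (form2 l2) =1 form1 (l2 p) \+ form2 l2 /\
     sym_DGLA (l2 p) l2).
Proof.
move=> l2_GLA p0 N Q.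
have mu_sym : sym_form 1 (form2 l2) by case: l2_GLA.
have mu_lin : multilinear (form2 l2) by case: mu_sym.
have p0' : 2 *: p \in piece E 0 by rewrite rpredZ.
have euler_form (x : E) :
    x \in piece E 0 -> sym_form 0 (form0 x \+ form1 (@euler K E)).
  by move=> x0; apply: sym_formD; [exact: sym_form0|exact: sym_form_euler].
have NmuE s : rn_bracket 0 1 N (form2 l2) s = form2 l2 (p :: s) + form2 l2 s.
  by rewrite (rn_bracket_euler p0 mu_sym) scale1r.
have Nmu_sym : sym_form 1 (rn_bracket 0 1 N (form2 l2)).
  apply: (eq_sym_form (fsym NmuE)).
  by apply: sym_formD => //; exact: sym_form_contract.
have square s : rn_bracket 0 1 N (rn_bracket 0 1 N (form2 l2)) s
    = rn_bracket 0 1 Q (form2 l2) s + form2 l2 [:: p, p & s].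
  rewrite (rn_bracket_euler p0 Nmu_sym).
  rewrite (rn_bracket_euler p0' mu_sym).
  rewrite (multilinearZ (s1 := [::])) //= !scale1r !NmuE scaler_nat mulr2n.
  by rewrite [RHS]addrC !addrA.
have nijP : nijenhuis (form2 l2) N Q <-> l2 p p = 0.
  split=> [[_ _ _ NN_Q _]|p_poisson].
    by have /eqP := square [::]; rewrite NN_Q -subr_eq0 opprD addrA subrr sub0r
      oppr_eq0 => /eqP.
  split=> //; try exact: euler_form.
    move=> s; rewrite square; case: s => [|x s] /=; last by rewrite addr0.
    by rewrite p_poisson addr0.
  move=> s; rewrite (rn_bracket_euler p0 (euler_form _ p0')) scale0r addr0.
  case: s => [|x s] /=; last by rewrite addr0.
  by rewrite add0r (eulerE p0) scale0r oppr0.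
split.
  by split=> [[/nijP]|/nijP nij] //; split=> //; exact: addr0.
move/nijP=> p_poisson; split.
  by move=> s; rewrite NmuE; case: s => [|x [|y s]].
split=> //.
- exact: sym_form_poisson.
- exact: poisson_square.
- move=> i x y xi; exact: jacobi_leibniz.
Qed.
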